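(* The set $$\mathcal{A}=\Big\{\alpha\in(0,1)\setminus\mathbb{Q}:\ \sum_{n=1}^{\infty}W_n(\alpha)<\infty\Big\}$$ satisfies $\lambda(\mathcal{A})=0$ and $\dim_{\mathrm H}(\mathcal{A})=\frac12$.
   Context: $\lambda$ is Lebesgue measure and $\dim_{\mathrm H}$ is Hausdorff dimension. For $\alpha\in(0,1)\setminus\mathbb{Q}$ let $\alpha=[a_1,a_2,\ldots]$ be its continued fraction expansion with $a_j\in\mathbb{N}$, $j\ge1$, and let $q_n$ be the denominators of its convergents: $q_{-1}=0$, $q_0=1$, $q_{n+1}=a_{n+1}q_n+q_{n-1}$. Define $$W_n=W_n(\alpha)=\begin{cases}\dfrac{\log q_{n+1}-\log q_n}{\log q_n}&\text{if } q_{n+1}<2q_n\log q_n,\\[2ex] \dfrac{\max\left\{1,\ \log\log q_n-\log\log\frac{q_{n+1}}{q_n\log q_n}\right\}}{\log q_n}&\text{if } q_{n+1}\ge 2q_n\log q_n,\end{cases}$$ for $n\ge1$ with $q_n\ge2$; a term with $q_n=1$ (possible only for $n=1$) is omitted from the sum. *)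

(* Defs.v *)
From mathcomp Require Import all_boot all_order all_algebra.
From mathcomp Require Import all_classical all_reals all_analysis.

Set Implicit Arguments.
Unset Strict Implicit.
Unset Printing Implicit Defensive.

Import Order.TTheory GRing.Theory Num.Theory.
Import numFieldNormedType.Exports.

Local Open Scope classical_set_scope.
Local Open Scope ring_scope.

Definition gauss_map (R : realType) (x : R) : R :=
  x^-1 - (Num.truncn x^-1)%:R.

(* The partial quotients of alpha = [a_1, a_2, ...] are a_j for j >= 1; the
   value at j = 0 is a dummy, never used by cf_denom.  For irrational alpha in (0,1) all
   iterates of the Gauss map stay irrational in (0,1). *)
Definition cf_digit (R : realType) (alpha : R) (j : nat) : nat :=
  Num.truncn (iter j.-1 (@gauss_map R) alpha)^-1.

(* The pair (q_(n-1), q_n), starting from (q_(-1), q_0) = (0, 1). *)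
Fixpoint cf_denom_pair (a : nat -> nat) (n : nat) : nat * nat :=
  if n is m.+1 then
    let: (q', q) := cf_denom_pair a m in (q, (a m.+1 * q + q')%N)
  else (0, 1)%N.

Definition cf_denom (R : realType) (alpha : R) (n : nat) : nat :=
  (cf_denom_pair (cf_digit alpha) n).2.

Definition W (R : realType) (alpha : R) (n : nat) : R :=
  let q : R := (cf_denom alpha n)%:R in
  let q1 : R := (cf_denom alpha n.+1)%:R in
  if q1 < 2 * q * ln q then (ln q1 - ln q) / ln q
  else Num.max 1 (ln (ln q) - ln (ln (q1 / (q * ln q)))) / ln q.

(* All the terms with q_n >= 2 are nonnegative, so the series has a value in
   [0, +oo], which is finite exactly when the series converges. *)
Definition calA (R : realType) : set R :=
  [set alpha | [/\ 0 < alpha < 1, irrational alpha &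
    (\sum_(1 <= n <oo | (2 <= cf_denom alpha n)%N) (W alpha n)%:E < +oo)%E]].

Arguments calA R : clear implicits.

Section Hausdorff.
Local Open Scope ereal_scope.
Context {R : realType} {V : normedModType R}.
Implicit Types (A U : set V) (s delta : R).

(* This is -oo for the empty set. *)
Definition diam U : \bar R :=
  ereal_sup [set `|xy.1 - xy.2|%:E | xy in U `*` U].

(* The term of a covering set U, diam U ^ s.  The empty set counts 0 for every s
   and a singleton counts 1 for s = 0 (as 0 `^ 0 = 1), so that the
   0-dimensional Hausdorff measure is the counting measure. *)
Definition diam_pow s U : \bar R :=
  if U == set0 then 0 else diam U `^ s.

Definition hausdorff_premeasure s delta A : \bar R :=
  ereal_inf [set \sum_(0 <= i <oo) diam_pow s (U i) | U in
    [set U : (set V)^nat |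
      A `<=` \bigcup_i U i /\ forall i, diam (U i) <= delta%:E]].

(* As delta decreases to 0 the premeasures increase, so that their limit is
   their supremum. *)
Definition hausdorff_measure s A : \bar R :=
  ereal_sup [set hausdorff_premeasure s delta A | delta in
    [set delta : R | (0 < delta)%R]].

Definition hausdorff_dim A : \bar R :=
  ereal_inf [set s%:E | s in
    [set s : R | (0 <= s)%R /\ hausdorff_measure s A = 0]].

End Hausdorff.

(* Main.v *)
Require Import Defs.
From mathcomp Require Import all_boot all_order all_algebra.
From mathcomp Require Import all_classical all_reals all_analysis.
From mathcomp Require Import ring lra zify.

Set Implicit Arguments.
Unset Strict Implicit.
Unset Printing Implicit Defensive.

Import Order.TTheory GRing.Theory Num.Theory.
Import numFieldNormedType.Exports.

Local Open Scope classical_set_scope.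
Local Open Scope ring_scope.

(** Let [x_n] be the [n]-th Gauss iterate of [alpha].  Two numbers with the same
    first [n] digits satisfy [|alpha - beta| = prod_(i < n) x_i y_i |x_n - y_n|],
    which is at most [q_n ^ -2].

    Upper bound: [W_n + W_(n+1) >= log 2 / log q_(n+1)], so that for [alpha] in
    the set [q_n >= C ^ n] infinitely often, for every [C].  The cylinder of a
    word [a_1 ... a_n] with [q_n >= C ^ n] has diameter at most [q_n ^ -2], and
    [q_n ^ -(1 + 2 d) <= C ^ (- n d) prod a_i ^ -(1 + d)]; the sum over all words
    of length [n] is at most [2 ^ -n] when [C] is large.  With [d = 1/2] this
    also shows that the set has Lebesgue measure zero.

    Lower bound: read off the [n]-th partial quotient of [g t] from the binary
    digits of [t] in positions [n ^ 3] to [(n + 1) ^ 3].  Then [q_n] is about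
    [2 ^ (n ^ 3)] and [W_n <= 2 / n ^ 2], so that [g] maps [[0, 1)] into the set,
    while [|t - u| <= K |g t - g u| ^ s] for every [s < 1/2]. *)

(** * Gauss orbits and continued fraction digits *)

Section Expansion.
Context {R : realType}.
Implicit Types (x y : R ^nat) (a : nat -> nat) (alpha : R).

(* [x] is the Gauss orbit of the number [a_1, a_2, ...]; as in [cf_digit] the
   value [a 0] is a dummy. *)
Definition cf_orbit x a :=
  forall n, 0 < x n < 1 /\ (x n)^-1 = (a n.+1)%:R + x n.+1.

Lemma gauss_map_itv alpha : 0 < alpha -> 0 <= gauss_map alpha < 1.
Proof.
move=> a0; rewrite /gauss_map subr_ge0 ltrBlDl natr1.
by rewrite truncn_itv// invr_ge0 ltW.
Qed.

Lemma irrational_gauss_map alpha : irrational alpha ->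
  irrational (gauss_map alpha).
Proof.
move=> ia [q _ qE]; apply: ia; exists (q + (Num.truncn alpha^-1)%:R)^-1 => //.
by rewrite fmorphV rmorphD /= ratr_nat qE /gauss_map subrK invrK.
Qed.

Lemma irrational_itv alpha : irrational alpha -> 0 <= alpha -> 0 < alpha.
Proof.
move=> ia; rewrite le_eqVlt => /orP[/eqP a0|//]; case: ia.
by exists 0 => //; rewrite rmorph0.
Qed.

Lemma gauss_orbit alpha : 0 < alpha < 1 -> irrational alpha ->
  cf_orbit (fun n => iter n (@gauss_map R) alpha) (cf_digit alpha).
Proof.
move=> a01 ia n.
have [xn01 ixn] : 0 < iter n (@gauss_map R) alpha < 1 /\
    irrational (iter n (@gauss_map R) alpha).
  elim: n => [//|n [/andP[xn0 _] ixn]] /=.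
  have /andP[g0 ->] := gauss_map_itv xn0; rewrite andbT.
  by have ig := irrational_gauss_map ixn; split => //; apply: irrational_itv.
by split => //=; rewrite /cf_digit /= /gauss_map addrC subrK.
Qed.

Lemma cf_orbit_digit_gt0 x a n : cf_orbit x a -> (0 < a n.+1)%N.
Proof.
move=> xa; have [/andP[x0 x1] xE] := xa n; have [/andP[_ y1] _] := xa n.+1.
rewrite lt0n; apply/negP => /eqP an; move: xE; rewrite an add0r => xE.
by move: y1; rewrite -xE invf_lt1// ltNge ltW.
Qed.

(** A converse to [gauss_orbit]: as [x n.+1] lies in [(0, 1)], the digit [a n.+1] is forced to be
    the integer part of [(x n)^-1]. *)
Lemma cf_orbit_gauss x a : cf_orbit x a ->
  forall n, iter n (@gauss_map R) (x 0) = x n.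
Proof.
move=> xa; elim=> [//|n IH] /=; rewrite IH /gauss_map.
have [_ ->] := xa n; have [/andP[y0 y1] _] := xa n.+1.
rewrite (_ : Num.truncn _ = a n.+1); first by rewrite addrC addKr.
by apply: truncn_def; rewrite lerDl ltW//= -natr1 ltrD2l.
Qed.

Lemma cf_orbit_digit x a : cf_orbit x a ->
  forall n, cf_digit (x 0) n.+1 = a n.+1.
Proof.
move=> xa n; rewrite /cf_digit /= (cf_orbit_gauss xa).
have [_ ->] := xa n; have [/andP[y0 y1] _] := xa n.+1.
by apply: truncn_def; rewrite lerDl ltW//= -natr1 ltrD2l.
Qed.

(* The numerators of the Gauss orbit of a rational number decrease. *)
Lemma cf_orbit_irrational x a : cf_orbit x a -> irrational (x 0).
Proof.
move=> xa.
have key (p : nat) : forall n (q : nat), (0 < q)%N -> x n = p%:R / q%:R -> False.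
  elim/ltn_ind: p => p IH n q q0 xnE.
  have [/andP[xn0 xn1] xE] := xa n; have [/andP[y0 y1] _] := xa n.+1.
  have p0 : (0 < p)%N.
    by rewrite lt0n; apply: contraTN xn0 => /eqP p0; rewrite xnE p0 mul0r ltxx.
  have pR : 0 < p%:R :> R by rewrite ltr0n.
  have qR : 0 < q%:R :> R by rewrite ltr0n.
  have yE : q%:R = (a n.+1 * p)%:R + x n.+1 * p%:R :> R.
    by rewrite natrM -mulrDl -xE xnE; field; rewrite !gt_eqF.
  have apq : (a n.+1 * p < q)%N.
    by rewrite -(ltr_nat R) yE ltrDl mulr_gt0.
  have yE' : x n.+1 = (q - a n.+1 * p)%:R / p%:R.
    by rewrite natrB ?(ltnW apq)// yE addrC addKr mulfK// gt_eqF.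
  apply: (IH _ _ n.+1 p p0 yE').
  rewrite -(ltr_nat R); move/(congr1 ( *%R^~ p%:R)): yE'.
  by rewrite divfK ?gt_eqF// => <-; rewrite -[ltRHS]mul1r ltr_pM2r.
case=> r _ rE; have [/andP[x0 _] _] := xa 0%N.
have r0 : 0 < r by rewrite -(ltr0q R) rE.
apply: (key `|numq r|%N 0%N `|denq r|%N); first by rewrite absz_gt0 denq_eq0.
rewrite -rE /ratr -[numq r]gez0_abs ?ltW ?numq_gt0//.
by rewrite -[denq r in LHS]gez0_abs ?ltW ?denq_gt0// !absz_nat.
Qed.

End Expansion.

(** * Growth of the denominators *)

Lemma cf_denom_pairS a n : cf_denom_pair a n.+1 =
  ((cf_denom_pair a n).2,
   (a n.+1 * (cf_denom_pair a n).2 + (cf_denom_pair a n).1)%N).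
Proof. by rewrite /=; case: (cf_denom_pair a n). Qed.

Lemma eq_cf_denom_pair a b n :
  (forall i, (0 < i <= n)%N -> a i = b i) -> cf_denom_pair a n = cf_denom_pair b n.
Proof.
elim: n => [//|n IH] ab; rewrite !cf_denom_pairS ab ?leqnn// IH// => i /andP[i0 ni].
by rewrite ab// i0 ltnW.
Qed.

Section Denominators.
Variable a : nat -> nat.
Hypothesis a_gt0 : forall i, (0 < a i.+1)%N.
Let q n := (cf_denom_pair a n).2.

Lemma cf_denom_gt0 n : (0 < q n)%N.
Proof.
by elim: n => [//|n IH]; rewrite /q cf_denom_pairS/= addn_gt0 muln_gt0 a_gt0 IH.
Qed.

Lemma cf_denom_pair_le n : ((cf_denom_pair a n).1 <= q n)%N.
Proof.
case: n => [//|n]; rewrite /q cf_denom_pairS/=.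
by rewrite (leq_trans _ (leq_addr _ _))// leq_pmull.
Qed.

Lemma cf_denomSS n : q n.+2 = (a n.+2 * q n.+1 + q n)%N.
Proof. by rewrite /q cf_denom_pairS (cf_denom_pairS a n). Qed.

Lemma cf_denom_leS n : (a n.+1 * q n <= q n.+1)%N.
Proof. by rewrite /q cf_denom_pairS/= leq_addr. Qed.

Lemma cf_denomS_le n : (q n.+1 <= (a n.+1).+1 * q n)%N.
Proof. by rewrite /q cf_denom_pairS/= mulSn addnC leq_add// cf_denom_pair_le. Qed.

Lemma prod_digit_le_denom n : (\prod_(i < n) a i.+1 <= q n)%N.
Proof.
elim: n => [|n IH]; first by rewrite big_ord0.
by rewrite big_ord_recr/= mulnC (leq_trans _ (cf_denom_leS n))// leq_mul.
Qed.

End Denominators.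

(** * Distance of two numbers with a common prefix of digits *)

Section Approximation.
Context {R : realType}.
Implicit Types (x y : R ^nat) (a : nat -> nat).

(** The factor that the product gains is lost by the bracket: [x_n (q_(n+1) + x_(n+1) q_n) = q_n +
    x_n q_(n-1)]. *)
Lemma prod_orbit_denom x a n : cf_orbit x a ->
  \prod_(i < n) x i *
    ((cf_denom_pair a n).2%:R + x n * (cf_denom_pair a n).1%:R) = 1.
Proof.
move=> xa; elim: n => [|n IH]; first by rewrite big_ord0/= mulr0 addr0 mulr1.
rewrite big_ord_recr/= -mulrA -[RHS]IH; congr (_ * _).
have [/andP[x0 _] xE] := xa n; case: (cf_denom_pair a n) => p q /=.
have -> : x n.+1 = (x n)^-1 - (a n.+1)%:R by rewrite xE addrC addKr.
by rewrite natrD natrM; field; rewrite gt_eqF.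
Qed.

Lemma prod_orbit_le x a n : cf_orbit x a ->
  \prod_(i < n) x i <= (cf_denom_pair a n).2%:R^-1.
Proof.
move=> xa; have a0 i := cf_orbit_digit_gt0 i xa.
have q0 := cf_denom_gt0 a0 n; have [/andP[x0 _] _] := xa n.
have P0 : 0 <= \prod_(i < n) x i.
  by apply: prodr_ge0 => i _; have [/andP[/ltW]] := xa i.
rewrite -div1r ler_pdivlMr ?ltr0n//.
rewrite -[leRHS](prod_orbit_denom n xa) ler_wpM2l// lerDl.
by rewrite mulr_ge0// ltW.
Qed.

(** A common digit cancels in [1 / y_n - 1 / x_n], whence
    [x_n - y_n = x_n y_n (y_(n+1) - x_(n+1))]. *)
Lemma cf_orbit_sub x y a b n : cf_orbit x a -> cf_orbit y b ->
  (forall i, (i < n)%N -> a i.+1 = b i.+1) ->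
  `|x 0 - y 0| = (\prod_(i < n) x i) * (\prod_(i < n) y i) * `|x n - y n|.
Proof.
move=> xa yb; elim: n => [|n IH] ab; first by rewrite !big_ord0 !mul1r.
rewrite IH; last by move=> i ni; rewrite ab// ltnW// ltnS.
rewrite !big_ord_recr/=.
have [/andP[x0 _] xE] := xa n; have [/andP[y0 _] yE] := yb n.
have -> : x n - y n = x n * y n * (y n.+1 - x n.+1).
  have -> : y n.+1 - x n.+1 = (y n)^-1 - (x n)^-1.
    by rewrite xE yE (ab n (leqnn _)); ring.
  by field; rewrite !gt_eqF.
by rewrite !normrM distrC (gtr0_norm x0) (gtr0_norm y0); ring.
Qed.

End Approximation.

(** * Fast growth of the denominators on [calA] *)

Section Upper.
Context {R : realType}.
Implicit Types (alpha C : R).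

Lemma cf_digit_gt0 alpha n : 0 < alpha < 1 -> irrational alpha ->
  (0 < cf_digit alpha n.+1)%N.
Proof. by move=> a01 ia; apply: cf_orbit_digit_gt0 (gauss_orbit a01 ia). Qed.

Section Terms.
Variable alpha : R.
Hypotheses (a01 : 0 < alpha < 1) (ia : irrational alpha).
Let q n : R := (cf_denom alpha n)%:R.
Let agt0 i : (0 < cf_digit alpha i.+1)%N := cf_digit_gt0 i a01 ia.

Lemma cf_denom_le : {homo cf_denom alpha : m n / (m <= n)%N}.
Proof.
apply: homo_leq; [exact: leqnn|exact: leq_trans|move=> n].
by rewrite (leq_trans _ (cf_denom_leS _ _))// leq_pmull.
Qed.

Lemma cf_denom_double n : (2 * cf_denom alpha n <= cf_denom alpha n.+2)%N.
Proof.
rewrite /cf_denom cf_denomSS mul2n -addnn leq_add2r.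
by rewrite (leq_trans (cf_denom_le (leqnSn n)))// leq_pmull.
Qed.

Lemma cf_denom_ge2 n : (2 <= n)%N -> (2 <= cf_denom alpha n)%N.
Proof. by move=> n2; rewrite (leq_trans _ (cf_denom_le n2))// (cf_denom_double 0). Qed.

Lemma cf_denom_ge1 n : (1 <= cf_denom alpha n)%N.
Proof. exact: cf_denom_gt0. Qed.

(** In the second branch of [W] the maximum with 1 keeps the numerator at least 1. *)
Lemma W_cases n : (2 <= cf_denom alpha n)%N ->
  (W alpha n = (ln (q n.+1) - ln (q n)) / ln (q n)) \/ (ln (q n))^-1 <= W alpha n.
Proof.
move=> q2; rewrite /W -/(q n) -/(q n.+1); case: ifPn => _; [by left|right].
rewrite -[leLHS]mul1r ler_wpM2r ?le_max ?lexx// invr_ge0 ln_ge0//.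
by rewrite ler1n ltnW.
Qed.

Lemma ln_cf_denom_gt0 n : (2 <= cf_denom alpha n)%N -> 0 < ln (q n).
Proof. by move=> q2; rewrite ln_gt0// ltr1n. Qed.

Lemma ln_cf_denom_le m n : (m <= n)%N -> ln (q m) <= ln (q n).
Proof.
move=> mn; rewrite ler_ln ?posrE ?ltr0n ?cf_denom_ge1//.
by rewrite ler_nat cf_denom_le.
Qed.

Lemma W_ge0 n : (2 <= cf_denom alpha n)%N -> 0 <= W alpha n.
Proof.
move=> q2; have l0 := ln_cf_denom_gt0 q2; case: (W_cases q2) => [->|].
  by rewrite divr_ge0 ?(ltW l0)// subr_ge0 ln_cf_denom_le.
by apply: le_trans; rewrite invr_ge0 ltW.
Qed.

Lemma ln2_le1 : ln 2 <= 1 :> R.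
Proof.
by have := @le_ln1Dx R 1; rewrite (_ : 1 + 1 = 2 :> R)//; apply; lra.
Qed.

(** If both terms are in the first case of [W_cases], then over the common denominator [log q_(n+1)]
    the numerators telescope to [log (q_(n+2) / q_n)], and denominators double every two steps.
    Otherwise one term alone is at least [1 / log q_(n+1)], and [log 2 <= 1]. *)
Lemma W_add_ge n : (2 <= cf_denom alpha n)%N ->
  ln 2 / ln (q n.+1) <= W alpha n + W alpha n.+1.
Proof.
move=> q2; have q2' : (2 <= cf_denom alpha n.+1)%N.
  by rewrite (leq_trans q2)// cf_denom_le.
have l0 := ln_cf_denom_gt0 q2; have l1 := ln_cf_denom_gt0 q2'.
have l01 := ln_cf_denom_le (leqnSn n).
have W0 := W_ge0 q2; have W1 := W_ge0 q2'.
have V01 : (ln (q n.+1))^-1 <= (ln (q n))^-1 by rewrite lef_pV2.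
have h : ln 2 / ln (q n.+1) <= (ln (q n.+1))^-1.
  by rewrite -[leRHS]mul1r ler_wpM2r ?ln2_le1// invr_ge0 ltW.
have [WE|W0'] := W_cases q2; last by lra.
have [WE'|W1'] := W_cases q2'; last by lra.
apply: (@le_trans _ _
    ((ln (q n.+1) - ln (q n)) / ln (q n.+1) +
     (ln (q n.+2) - ln (q n.+1)) / ln (q n.+1))).
  rewrite -mulrDl ler_wpM2r ?invr_ge0 ?(ltW l1)//.
  have : ln (2 * q n) <= ln (q n.+2).
    rewrite ler_ln ?posrE ?mulr_gt0 ?ltr0n ?cf_denom_ge1//.
    by rewrite -natrM ler_nat cf_denom_double.
  rewrite lnM ?posrE ?ltr0n ?cf_denom_ge1// => h2; lra.
by rewrite WE WE' lerD2r ler_wpM2l// subr_ge0.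
Qed.

End Terms.

(* Otherwise [1 / log q_(n+1) <= (W_n + W_(n+1)) / log 2] would make the
   harmonic series converge. *)
Lemma calA_denom_ge alpha C N : calA R alpha -> 1 < C ->
  exists2 n, (N <= n)%N & C ^+ n <= (cf_denom alpha n)%:R.
Proof.
move=> [a01 ia Sfin] C1; apply: contrapT => noq.
have qlt n : (N <= n)%N -> (cf_denom alpha n)%:R < C ^+ n.
  by move=> Nn; rewrite ltNge; apply/negP => Cq; apply: noq; exists n.
have lnC : 0 < ln C by rewrite ln_gt0.
have ln2 : 0 < ln 2 :> R by rewrite ln_gt0// ltr1n.
pose u n : R := if (1 <= n)%N && (2 <= cf_denom alpha n)%N then W alpha n else 0.
have u0 n : 0 <= u n by rewrite /u; case: ifPn => // /andP[_ /W_ge0]; apply.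
pose S : R := fine (\sum_(1 <= n <oo | (2 <= cf_denom alpha n)%N) (W alpha n)%:E)%E.
have Sge n : \sum_(0 <= i < n) u i <= S.
  rewrite -lee_fin /S fineK; last first.
    rewrite ge0_fin_numE//; apply: nneseries_ge0 => i _ /W_ge0.
    by rewrite lee_fin; apply.
  case: n => [|n].
    rewrite big_geq//; apply: nneseries_ge0 => i _ /W_ge0.
    by rewrite lee_fin; apply.
  rewrite big_ltn// {1}/u/= add0r.
  apply: le_trans (nneseries_lim_ge n.+1 _); last first.
    by move=> i _ /W_ge0; rewrite lee_fin; apply.
  rewrite -sumEFin big_mkcond [leRHS]big_mkcond/= big_nat [leRHS]big_nat.
  apply: lee_sum => i /andP[i1 _]; rewrite /u i1/=.
  by case: ifP.
pose M := maxn N 2; pose K : R := ln C / ln 2.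
have K0 : 0 < K by rewrite divr_gt0.
(* Here [harmonic i] is [1 / (i + 1)], and [q_(i+1) < C ^ (i + 1)] gives
   [1 / (i + 1) <= log C / log q_(i+1)]. The indicator pays for the finitely many indices below
   [M]. *)
have hle i : harmonic i <= (i < M)%N%:R + K * (u i + u i.+1).
  rewrite /harmonic; case: ltnP => [iM|].
    rewrite (@le_trans _ _ 1)//; first by rewrite invf_le1 ?ltr0n// ler1n.
    by rewrite lerDl mulr_ge0// ?addr_ge0// ltW.
  rewrite geq_max => /andP[Ni i2]; rewrite add0r.
  have q2 := cf_denom_ge2 a01 ia i2.
  have q2' := cf_denom_ge2 a01 ia (leq_trans i2 (leqnSn i)).
  rewrite /u (leq_trans _ i2)// q2 q2'/=.
  apply: le_trans (ler_wpM2l (ltW K0) (W_add_ge a01 ia q2)).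
  rewrite /K mulrA divfK ?gt_eqF// ler_pdivlMr ?ln_cf_denom_gt0// mulrC.
  rewrite ler_pdivrMr ?ltr0n// mulrC mulr_natl -lnXn; last by rewrite (lt_trans _ C1).
  rewrite ler_ln ?posrE ?exprn_gt0 ?(lt_trans _ C1)//
    ?ltW ?qlt// ?ltr0n ?(leq_trans _ q2')//.
  by rewrite (leq_trans Ni).
apply: (@dvg_harmonic R); apply: nondecreasing_is_cvgn.
  by apply: nondecreasing_series => i _ _; rewrite harmonic_ge0.
exists (M%:R + K * (S + S)) => _ [n _ <-].
rewrite /series/=; apply: le_trans (ler_sum _ (fun i _ => hle i)) _.
rewrite big_split/= -mulr_sumr big_split/=. apply: lerD.
  rewrite -natr_sum ler_nat -big_mkcond/= sum1_count.
  rewrite -size_filter; apply: (@leq_trans (size (iota 0 M))); last by rewrite size_iota.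
  apply: uniq_leq_size; first by rewrite filter_uniq// iota_uniq.
  by move=> i; rewrite mem_filter mem_iota add0n leq0n/= => /andP[].
rewrite ler_wpM2l ?(ltW K0)// lerD// (le_trans _ (Sge n.+1))//.
by rewrite [leRHS]big_nat_recl//= lerDr.
Qed.

End Upper.

(** * Weighted sums over finite words *)

Fixpoint words (M n : nat) : seq (seq nat) :=
  if n is m.+1 then [seq a :: w | a <- iota 0 M, w <- words M m] else [:: [::]].

Lemma mem_words M w : all (fun a => a < M)%N w -> w \in words M (size w).
Proof.
elim: w => [_|a w IH /= /andP[aM wM]]; first by rewrite mem_seq1.
by apply: allpairs_f; rewrite ?IH// mem_iota.
Qed.

Section Sums.
Context {R : realType}.

Lemma ler_sum_uniq_sub (T : eqType) (f : T -> R) (s t : seq T) :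
  (forall x, 0 <= f x) -> uniq s -> {subset s <= t} ->
  \sum_(x <- s) f x <= \sum_(x <- t) f x.
Proof.
move=> f0; elim: s t => [|x s IH] t /=; first by rewrite big_nil sumr_ge0.
move=> /andP[xs us] st; have xt : x \in t by rewrite st ?mem_head.
rewrite big_cons (perm_big _ (perm_to_rem xt)) big_cons/= lerD2l.
apply: IH => // y ys; have : y \in t by rewrite st// inE ys orbT.
rewrite (perm_mem (perm_to_rem xt)) inE => /orP[/eqP yx|//].
by rewrite yx (negbTE xs) in ys.
Qed.

(** The weight is multiplicative in the letters, so that the sum is an expanded [n]-th power. *)
Lemma sum_words (h : nat -> R) (c : R) M n :
  \sum_(w <- words M n) c ^+ size w * \prod_(a <- w) h a =
  (c * \sum_(a <- iota 0 M) h a) ^+ n.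
Proof.
elim: n => [|n IH] /=; first by rewrite big_seq1 big_nil mulr1 expr0.
rewrite big_allpairs_dep exprS -IH [X in X * _]mulr_sumr mulr_suml.
apply: eq_bigr => a _; rewrite mulr_sumr; apply: eq_bigr => w _ /=.
by rewrite big_cons exprS; ring.
Qed.

Lemma sum_half_iota N L : \sum_(n <- iota N L) (2^-1 : R) ^+ n <= 2 * 2^-1 ^+ N.
Proof.
elim: L N => [|L IH] N /=; first by rewrite big_nil mulr_ge0.
rewrite big_cons (_ : 2 * _ = 2^-1 ^+ N + 2 * 2^-1 ^+ N.+1 :> R); first by rewrite lerD2l.
by rewrite exprS mulrA divff ?pnatr_eq0// mul1r mulr_natl mulr2n.
Qed.

(** The words of each length [n] contribute at most [(c Z) ^ n <= 2 ^ -n]. The bound does not depend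
    on the finite family [s], so that it passes to infinite sums. *)
Lemma sum_long_words (h : nat -> R) (c Z : R) (s : seq (seq nat)) N :
  (forall a, 0 <= h a) -> 0 <= c -> c * Z <= 2^-1 ->
  (forall M, \sum_(a <- iota 0 M) h a <= Z) ->
  uniq s -> all (fun w => N <= size w)%N s ->
  \sum_(w <- s) c ^+ size w * \prod_(a <- w) h a <= 2 * 2^-1 ^+ N.
Proof.
move=> h0 c0 cZ hZ us sN.
pose M := (\max_(a <- flatten s) a).+1; pose L := (\max_(w <- s) size w).+1.
apply: (@le_trans _ _ (\sum_(w <- flatten [seq words M n | n <- iota N L])
    c ^+ size w * \prod_(a <- w) h a)).
  apply: ler_sum_uniq_sub => // [w|w ws].
    by rewrite mulr_ge0 ?exprn_ge0// prodr_ge0.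
  apply/flatten_mapP; exists (size w).
    rewrite mem_iota (allP sN)//= ltn_addl// ltnS.
    by rewrite (big_rem w)//= leq_maxl.
  apply: mem_words; apply/allP => a aw; rewrite ltnS.
  by rewrite (big_rem a) ?leq_maxl//; apply/flattenP; exists w.
rewrite big_flatten big_map; apply: le_trans (sum_half_iota N L).
apply: ler_sum => n _; rewrite sum_words lerXn2r ?nnegrE//.
  by rewrite mulr_ge0// sumr_ge0.
by apply: le_trans cZ; rewrite ler_wpM2l.
Qed.

(** The right side is the integral of [t ^ -(1 + d)] over [[x - 1, x]]. After division by [x ^ -d]
    the claim becomes [(1 - 1 / x) ^ -d >= 1 + d / x], which follows from [exp z >= 1 + z] and
    [log (1 - 1 / x) <= - 1 / x]. *)
Lemma powR_succ_le (d x : R) : 0 < d -> 1 < x ->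
  x `^ (- (1 + d)) <= d^-1 * ((x - 1) `^ (- d) - x `^ (- d)).
Proof.
move=> d0 x1; have x0 : 0 < x by lra.
have x10 : 0 < 1 - x^-1 by rewrite subr_gt0 invf_lt1.
have -> : x - 1 = x * (1 - x^-1) by rewrite mulrBr mulr1 divff// gt_eqF.
rewrite powRM ?(ltW x0) ?(ltW x10)// opprD powRD; last by rewrite (gt_eqF x0) implybT.
rewrite powR_inv1 ?(ltW x0)// mulrC -[X in _ - X]mulr1 -mulrBr mulrCA.
rewrite ler_wpM2l ?powR_ge0// mulrC ler_pdivlMr// lerBrDl.
rewrite /powR gt_eqF//; apply: le_trans (expR_ge1Dx _); rewrite lerD2l.
rewrite mulNr -mulrN mulrC ler_wpM2l ?(ltW d0)// lerNr.
by apply: le_ln1Dx; rewrite ltrN2 invf_lt1.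
Qed.

Lemma sum_powR_le (d : R) M : 0 < d ->
  \sum_(a <- iota 0 M) a%:R `^ (- (1 + d)) <= 1 + d^-1.
Proof.
(* A nonzero exponent makes the power of 0 equal to 0, so that the letter 0 adds nothing. *)
move=> d0; have d10 : - (1 + d) != 0 by rewrite oppr_eq0 gt_eqF// ltr_wpDl.
have key n : \sum_(a <- iota 0 n.+2) a%:R `^ (- (1 + d)) <=
    1 + d^-1 * (1 - n.+1%:R `^ (- d)).
  elim: n => [|n IH].
    by rewrite /= big_cons big_seq1 powR0// add0r !powR1 subrr mulr0 addr0.
  rewrite -[n.+3]addn1 iotaD big_cat big_seq1 add0n.
  have := @powR_succ_le d n.+2%:R d0; rewrite ltr1n => /(_ isT).
  rewrite (_ : n.+2%:R - 1 = n.+1%:R); last by rewrite -[n.+2%:R]natr1 addrK.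
  by move=> h; move: (lerD IH h); rewrite !mulrBr mulr1 /= => h2; lra.
apply: (@le_trans _ _ (\sum_(a <- iota 0 M.+2) a%:R `^ (- (1 + d)))).
  rewrite -[M.+2]addn2 iotaD big_cat/= lerDl.
  by apply: sumr_ge0 => a _; apply: powR_ge0.
apply: le_trans (key M) _; rewrite lerD2l -[leRHS]mulr1.
by rewrite ler_wpM2l ?invr_ge0 ?(ltW d0)// gerBl powR_ge0.
Qed.

End Sums.

(** * Covers of [calA] by cylinders, and the upper bound *)

Section Cover.
Context {R : realType}.
Implicit Types (alpha beta C d : R) (w : seq nat).

(** The denominator depends on [w] alone, so that this is either the whole cylinder of [w] or
    empty. *)
Definition big_cylinder C w : set R :=
  [set alpha | [/\ 0 < alpha < 1, irrational alpha,
    forall i, (i < size w)%N -> cf_digit alpha i.+1 = nth 0%N w i &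
    C ^+ size w <= (cf_denom alpha (size w))%:R]].

Lemma big_cylinder_dist C w alpha beta :
  big_cylinder C w alpha -> big_cylinder C w beta ->
  `|alpha - beta| <= (cf_denom alpha (size w))%:R ^- 2.
Proof.
move=> [a01 ia aw _] [b01 ib bw _].
have xa := gauss_orbit a01 ia; have yb := gauss_orbit b01 ib.
have ab i : (i < size w)%N -> cf_digit alpha i.+1 = cf_digit beta i.+1.
  by move=> iw; rewrite aw// bw.
rewrite (cf_orbit_sub xa yb ab) -[leRHS]mulr1 -exprVn expr2.
have prod0 (x : R ^nat) (a : nat -> nat) : cf_orbit x a ->
    0 <= \prod_(i < size w) x i.
  by move=> xa'; apply: prodr_ge0 => i _; have [/andP[/ltW]] := xa' i.
apply: ler_pM => //; first by rewrite mulr_ge0 ?(prod0 _ _ xa) ?(prod0 _ _ yb).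
  apply: ler_pM; rewrite ?(prod0 _ _ xa) ?(prod0 _ _ yb) ?(prod_orbit_le _ xa)//.
  apply: le_trans (prod_orbit_le _ yb) _.
  rewrite /cf_denom (@eq_cf_denom_pair (cf_digit alpha) (cf_digit beta))//.
  by move=> [//|i] /andP[_ iw]; rewrite ab.
have [/andP[? ?] _] := xa (size w); have [/andP[? ?] _] := yb (size w).
by rewrite ler_norml; apply/andP; split; lra.
Qed.

Lemma prod_powR (s : seq nat) (r : R) :
  \prod_(a <- s) a%:R `^ r = (\prod_(a <- s) a)%:R `^ r.
Proof.
elim: s => [|a s IH]; first by rewrite !big_nil powR1.
by rewrite !big_cons IH natrM powRM.
Qed.

Lemma big_cylinder_diam C w alpha : big_cylinder C w alpha ->
  (0 <= diam (big_cylinder C w) <=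
   ((cf_denom alpha (size w))%:R ^- 2)%:E)%E.
Proof.
move=> wa; apply/andP; split.
  apply: ereal_sup_ubound; exists (alpha, alpha) => //=.
  by rewrite subrr normr0.
apply: ge_ereal_sup => _ [[b c] /= [wb wc] <-]; rewrite lee_fin.
apply: le_trans (big_cylinder_dist wb wc) _.
have [_ _ aw _] := wa; have [_ _ bw _] := wb.
rewrite /cf_denom (@eq_cf_denom_pair (cf_digit b) (cf_digit alpha))//.
by move=> [//|i] /andP[_ iw]; rewrite aw// bw.
Qed.

Lemma big_cylinder_diam_pow d C w : 0 < d -> 1 < C ->
  (diam_pow (2^-1 + d) (big_cylinder C w) <=
   ((C `^ (- d)) ^+ size w * \prod_(a <- w) a%:R `^ (- (1 + d)))%:E)%E.
Proof.
move=> d0 C1; rewrite /diam_pow; case: ifPn => [_|/set0P[alpha wa]].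
  rewrite lee_fin mulr_ge0 ?exprn_ge0 ?powR_ge0//.
  by apply: prodr_ge0 => a _; apply: powR_ge0.
have /andP[D0 Dq] := big_cylinder_diam wa.
have [a01 ia aw Cq] := wa.
set q := (cf_denom alpha (size w))%:R in Cq Dq.
have digit0 i := cf_digit_gt0 i a01 ia.
have q0 : 0 < q by rewrite ltr0n cf_denom_gt0.
have C0 : 0 < C by apply: lt_trans C1.
have wq : (\prod_(a <- w) a)%:R <= q.
  rewrite ler_nat (big_nth 0%N) big_mkord.
  rewrite (eq_bigr (fun i : 'I_(size w) => cf_digit alpha i.+1)).
    exact: prod_digit_le_denom.
  by move=> i _; rewrite aw.
have w0 : 0 < (\prod_(a <- w) a)%:R :> R.
  rewrite ltr0n (big_nth 0%N) big_mkord prodn_gt0// => i.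
  by rewrite -aw.
apply: le_trans (gt0_ler_poweR _ _ _ Dq) _.
- by rewrite addr_ge0// ltW.
- by rewrite in_itv/= D0 leey.
- by rewrite in_itv/= leey andbT lee_fin invr_ge0 exprn_ge0// ltW.
rewrite poweR_EFin lee_fin prod_powR.
have -> : q ^- 2 = q `^ (- 2) by rewrite powRN powR_mulrn// ltW.
(* The factor [q ^ -d] is spent on [C ^ n <= q], with [n] the length of [w], and the factor
   [q ^ -(1 + d)] on the product of the digits being at most [q]. *)
rewrite -powRrM (_ : - 2 * (2^-1 + d) = - d + - (1 + d)); last by field.
rewrite powRD; last by rewrite (gt_eqF q0) implybT.
have leN (x y r : R) : 0 < x -> x <= y -> 0 <= r -> y `^ (- r) <= x `^ (- r).
  move=> x0 xy r0; have y0 := lt_le_trans x0 xy.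
  rewrite !powRN lef_pV2 ?posrE ?powR_gt0//.
  by rewrite ge0_ler_powR ?nnegrE// ltW.
apply: ler_pM; rewrite ?powR_ge0//; last by rewrite leN// addr_ge0// ltW.
rewrite -powR_mulrn ?powR_ge0// -powRrM mulrC powRrM powR_mulrn ?(ltW C0)//.
by rewrite leN ?exprn_gt0// ltW.
Qed.

Lemma half_expn_lt (e : R) : 0 < e -> exists N, 2 * 2^-1 ^+ N <= e.
Proof.
move=> e0; pose N := (Num.truncn (2 / e)).+1; exists N.
rewrite exprVn ler_pdivrMr ?exprn_gt0// mulrC -ler_pdivrMr//.
apply: (@le_trans _ _ N%:R); last by rewrite -natrX ler_nat ltnW// ltn_expl.
by have /andP[_ /ltW] := @truncn_itv R (2 / e) (ltW (divr_gt0 (ltr0Sn R 1) e0)).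
Qed.

Lemma diam_pow_ge0 s (U : set R) : (0 <= diam_pow s U)%E.
Proof. by rewrite /diam_pow; case: ifP => // _; exact: poweR_ge0. Qed.

Lemma hausdorff_premeasure_ge0 s delta (A : set R) :
  (0 <= hausdorff_premeasure s delta A)%E.
Proof.
apply/ereal_infP => _ [U _ <-].
by apply: nneseries_ge0 => i _ _; exact: diam_pow_ge0.
Qed.

Lemma calA_hausdorff_measure0 d : 0 < d ->
  hausdorff_measure (2^-1 + d) (calA R) = 0%E.
Proof.
move=> d0; apply/eqP; rewrite eq_le; apply/andP; split; last first.
  apply: le_ereal_sup_tmp; exists (hausdorff_premeasure (2^-1 + d) 1 (calA R)).
    by exists 1 => //=.
  exact: hausdorff_premeasure_ge0.
apply: ge_ereal_sup => _ [delta /= delta0 <-].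
apply/lee_addgt0Pr => e e0; rewrite add0e.
(* A single [N] has to bring the total weight below [e] and all diameters below [delta]. *)
have ed0 : 0 < Num.min e delta by rewrite lt_min e0.
have [N] := half_expn_lt ed0; rewrite le_min => /andP[Ne Nd].
pose Z : R := 1 + d^-1; have Z0 : 0 < Z by rewrite addr_gt0// invr_gt0.
(* The second summand gives [C ^ d >= 2 Z], so that each letter contributes a factor of at most 1/2.
   The summand 2 gives [q >= 2 ^ N] on words of length at least [N], which bounds the diameters. *)
pose C := 2 + (2 * Z) `^ d^-1.
have C2 : 2 <= C by rewrite lerDl powR_ge0.
have C1 : 1 < C by lra.
have CZ : C `^ (- d) * Z <= 2^-1.
  rewrite -ler_pdivlMr// powRN -invfM lef_pV2 ?posrE ?powR_gt0 ?mulr_gt0//; last by lra.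
  have {1}-> : 2 * Z = ((2 * Z) `^ d^-1) `^ d.
    by rewrite -powRrM mulVf ?gt_eqF// powRr1// mulr_ge0// ltW.
  by apply: ge0_ler_powR; rewrite ?nnegrE ?powR_ge0 ?(ltW d0)//;
    rewrite /C ?addr_ge0 ?powR_ge0// lerDr.
(* The cover is indexed by the codes of words; the other indices, and the codes of words shorter
   than [N], get the empty set, whose diameter is [-oo]. *)
pose U (i : nat) : set R :=
  if pickle_inv i is Some w then
    if (N <= size w)%N then big_cylinder C w else set0 else set0.
apply: ge_ereal_inf; exists (\sum_(0 <= i <oo) diam_pow (2^-1 + d) (U i))%E.
  exists U => //; split.
    move=> alpha Aa; have [n Nn Cq] := calA_denom_ge N Aa C1.
    have [a01 ia _] := Aa.
    exists (pickle (mkseq (fun i => cf_digit alpha i.+1) n)) => //.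
    rewrite /U pickleK_inv size_mkseq Nn; split; rewrite ?size_mkseq//.
    by move=> i ni; rewrite nth_mkseq.
  move=> i; rewrite /U; case: pickle_inv => [w|]; last first.
    by apply: ge_ereal_sup => _ [? [[]]].
  case: ifPn => [Nw|_]; last by apply: ge_ereal_sup => _ [? [[]]].
  have [->|/set0P[alpha wa]] := eqVneq (big_cylinder C w) set0.
    by apply: ge_ereal_sup => _ [? [[]]].
  have /andP[_ /le_trans] := big_cylinder_diam wa; apply.
  have [a01 ia aw Cq] := wa; rewrite lee_fin (le_trans _ Nd)//.
  set q := (cf_denom alpha (size w))%:R in Cq *.
  have q1 : 1 <= q by rewrite ler1n cf_denom_gt0// => j; exact: cf_digit_gt0.
  apply: (@le_trans _ _ q^-1).
    by rewrite lef_pV2 ?posrE ?exprn_gt0 ?(lt_le_trans ltr01 q1)//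
      expr2 ler_peMl// (le_trans ler01).
  apply: (@le_trans _ _ (2^-1 ^+ N)); last by rewrite ler_peMl ?exprn_ge0// ler1n.
  rewrite exprVn lef_pV2 ?posrE ?exprn_gt0 ?(lt_le_trans ltr01 q1)//.
  apply: le_trans Cq; apply: (@le_trans _ _ (2 ^+ size w)).
    by rewrite ler_weXn2l// ler1n.
  by rewrite lerXn2r// nnegrE; lra.
apply: lime_le; first by apply: is_cvg_nneseries => *; exact: diam_pow_ge0.
apply: nearW => K; apply: (@le_trans _ _ (2 * 2^-1 ^+ N)%:E); last by rewrite lee_fin.
(* As [pickle_inv] is injective where it is defined, the first [K] indices yield a list of distinct
   words, to which [sum_long_words] applies. *)
pose s : seq (seq nat) := [seq w <- pmap pickle_inv (index_iota 0 K) | (N <= size w)%N].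
pose f w : R := (C `^ (- d)) ^+ size w * \prod_(a <- w) a%:R `^ (- (1 + d)).
apply: (@le_trans _ _ (\sum_(w <- s) f w)%:E); last first.
  rewrite lee_fin; apply: (sum_long_words (Z := Z)) => //.
  - exact: powR_ge0.
  - by move=> M; exact: sum_powR_le.
  - by rewrite filter_uniq// (pmap_uniq (@pickle_invK _))// iota_uniq.
  - exact: filter_all.
have -> : \sum_(w <- s) f w = \sum_(0 <= i < K)
    oapp (fun w => if (N <= size w)%N then f w else 0) 0 (pickle_inv i).
  by rewrite /s big_filter big_mkcond; exact: big_pmap.
rewrite -sumEFin.
apply: lee_sum => i _; rewrite /U; case: (pickle_inv i) => [w|] /=; last first.
  by rewrite /diam_pow eqxx.
case: ifPn => _; last by rewrite /diam_pow eqxx.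
exact: big_cylinder_diam_pow.
Qed.

End Cover.

(** * Lebesgue measure against Hausdorff premeasures *)

Section SmallCovers.
Context {R : realType}.
Implicit Types (A U : set R) (r s : R).

(** On arbitrary sets [lebesgue_measure] is an outer measure, hence monotone. *)
Lemma lebesgue_measure_le A B : A `<=` B ->
  (@lebesgue_measure R A <= @lebesgue_measure R B)%E.
Proof. by move=> AB; exact: le_mu_ext. Qed.

(** A nonempty [T i] lies in the closed interval of radius [r i] about any of its points. This
    measurable hull brings in the factor 2. *)
Lemma lebesgue_measure_le_sum A (T : (set R)^nat) (r : R^nat) :
  (forall i, 0 <= r i) -> A `<=` \bigcup_i T i ->
  (forall i t u, T i t -> T i u -> `|t - u| <= r i) ->
  (@lebesgue_measure R A <= \sum_(0 <= i <oo) (2 * r i)%:E)%E.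
Proof.
move=> r0 AT Tr.
have /choice[I HI] : forall i, exists J : set R, [/\ measurable J, T i `<=` J &
    (@lebesgue_measure R J <= (2 * r i)%:E)%E].
  move=> i; have [->|/set0P[x Tx]] := eqVneq (T i) set0.
    by exists set0; split => //; rewrite measure0 lee_fin mulr_ge0.
  exists `[x - r i, x + r i]%classic; split => //.
    move=> t Tt; rewrite /= in_itv/=; have := Tr i t x Tt Tx.
    by rewrite ler_norml => /andP[? ?]; apply/andP; split; lra.
  rewrite lebesgue_measure_itv/=; case: ifP => _.
    by rewrite -EFinD lee_fin; lra.
  by rewrite lee_fin mulr_ge0.
apply: le_trans (lebesgue_measure_le (_ : _ `<=` \bigcup_i I i)) _.
  by move=> t /AT[i _ Tit]; exists i => //; have [_ + _] := HI i; exact.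
have mI i : measurable (I i) by have [] := HI i.
have mU : measurable (\bigcup_i I i) by exact: bigcup_measurable.
have := @measure_sigma_subadditive _ _ _ (@lebesgue_measure R) _ _ mI mU
  (@subset_refl _ _).
move=> /le_trans; apply.
by apply: lee_nneseries => // i _; have [] := HI i.
Qed.

Lemma diam_bound U delta x y : (diam U <= delta%:E)%E -> U x -> U y ->
  [/\ diam U \is a fin_num, 0 <= fine (diam U) & `|x - y| <= fine (diam U)].
Proof.
move=> Ud Ux Uy.
have Dxy : (`|x - y|%:E <= diam U)%E.
  by apply: ereal_sup_ubound; exists (x, y).
have D0 : (0 <= diam U)%E by apply: le_trans Dxy; rewrite lee_fin.
have fD : diam U \is a fin_num.
  by rewrite ge0_fin_numE// (le_lt_trans Ud)// ltry.
by split; rewrite ?fine_ge0// -lee_fin fineK.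
Qed.

(** A cover of [A] pulls back along [g] to a cover of [B], and the Hölder bound on the inverse of
    [g] makes the diameter of the preimage of [U i] at most [K] times the [s]-th power of that of
    [U i]. *)
Lemma lebesgue_le_hausdorff (B A : set R) (g : R -> R) (K s delta : R) :
  0 <= s -> 0 < K ->
  (forall t, B t -> A (g t)) ->
  (forall t u, B t -> B u -> `|t - u| <= K * `|g t - g u| `^ s) ->
  (@lebesgue_measure R B <= (2 * K)%:E * hausdorff_premeasure s delta A)%E.
Proof.
move=> s0 K0 BA gK; have K20 : 0 < 2 * K by rewrite mulr_gt0.
rewrite -lee_pdivrMl//; apply/ereal_infP => _ [U [AU Ud] <-].
rewrite lee_pdivrMl// -nneseriesZl; last by move=> i _; exact: diam_pow_ge0.
pose T i := B `&` g @^-1` U i.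
(* The empty set is set apart: for [s = 0] its diameter, read as 0 by [fine], would count 1, whereas
   [diam_pow] counts it 0. *)
pose r i := if U i == set0 then 0 else K * fine (diam (U i)) `^ s.
apply: (@le_trans _ _ (\sum_(0 <= i <oo) (2 * r i)%:E)%E).
  apply: (@lebesgue_measure_le_sum _ T).
  - by move=> i; rewrite /r; case: ifP => // _; rewrite mulr_ge0 ?powR_ge0// ltW.
  - by move=> t Bt; have [i _ Ui] := AU _ (BA _ Bt); exists i.
  - move=> i t u [Bt Ut] [Bu Uu]; rewrite /r ifN; last by apply/set0P; exists (g t).
    have [_ D0 Dtu] := diam_bound (Ud i) Ut Uu.
    apply: le_trans (gK _ _ Bt Bu) _; rewrite ler_wpM2l ?(ltW K0)//.
    by apply: ge0_ler_powR; rewrite ?nnegrE.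
apply: lee_nneseries => i _; rewrite /r /diam_pow; case: ifPn => [_|/set0P[x Ux]].
- by rewrite mulr0.
- by rewrite lee_fin !mulr_ge0 ?powR_ge0// ltW.
- by rewrite mulr0 mule0.
- have [fD _ _] := diam_bound (Ud i) Ux Ux.
  by rewrite -{2}(fineK fD) poweR_EFin -EFinM mulrA.
Qed.

Lemma hausdorff_measure1_null A :
  hausdorff_measure 1 A = 0%E -> @lebesgue_measure R A = 0%E.
Proof.
move=> A0; apply/eqP; rewrite eq_le measure_ge0 andbT.
have -> : 0%E = ((2 * 1)%:E * 0)%E :> \bar R by rewrite mule0.
apply: (@le_trans _ _ ((2 * 1)%:E * hausdorff_premeasure 1 1 A)%E).
  apply: (@lebesgue_le_hausdorff A A id) => // t u _ _.
  by rewrite mul1r powRr1.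
rewrite lee_pmul2l// -A0; apply: ereal_sup_ubound.
by exists 1 => //=.
Qed.

End SmallCovers.

(** * Infinite continued fractions with prescribed digits *)

Section InfiniteFraction.
Context {R : realType}.
Implicit Types (a : nat -> nat).

Definition shift_digits n a i := a (n + i)%N.

(** This is [[a_0, ..., a_(k-1)]]. The digits are indexed from 0 here and from 1 in [cf_orbit],
    which explains [a j.-1] in [inf_cf_orbit]. *)
Fixpoint fin_cf k a : R :=
  if k is k'.+1 then ((a 0%N)%:R + fin_cf k' (shift_digits 1 a))^-1 else 0.

Definition inf_cf a : R := limn (fin_cf ^~ a).

Section Digits.
Variable a : nat -> nat.
Hypothesis a_ge2 : forall i, (2 <= a i)%N.

Lemma fin_cf_itv k n : 0 <= fin_cf k (shift_digits n a) <= 2^-1.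
Proof.
elim: k n => [|k IH] n /=; first by rewrite lexx/= invr_ge0.
have an2 : 2 <= (shift_digits n a 0)%:R :> R by rewrite ler_nat a_ge2.
have /andP[h0 _] : 0 <= fin_cf k (shift_digits 1 (shift_digits n a)) <= 2^-1.
  rewrite (_ : shift_digits _ _ = shift_digits n.+1 a); first exact: IH.
  by apply/funext => i; rewrite /shift_digits add1n addSnnS.
by rewrite invr_ge0 addr_ge0//= lef_pV2 ?posrE//; lra.
Qed.

(** With [A >= 2] the map sending [u >= 0] to [1 / (A + u)] at least halves distances, so that
    consecutive truncations approach each other geometrically. *)
Lemma fin_cf_step k n :
  `|fin_cf k.+1 (shift_digits n a) - fin_cf k (shift_digits n a)| <= 2^-1 ^+ k.
Proof.
elim: k n => [|k IH] n.
  rewrite expr0 subr0; have /andP[h0 h1] := fin_cf_itv 1 n.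
  by rewrite ger0_norm//; lra.
have sE : shift_digits 1 (shift_digits n a) = shift_digits n.+1 a.
  by apply/funext => i; rewrite /shift_digits add1n addSnnS.
have an2 : 2 <= (shift_digits n a 0)%:R :> R by rewrite ler_nat a_ge2.
have /andP[h0 _] := fin_cf_itv k n.+1; have /andP[g0 _] := fin_cf_itv k.+1 n.+1.
have {IH} := IH n.+1; set v := fin_cf k.+1 _ in g0 *; set u := fin_cf k _ in h0 *.
move=> uv.
have -> : fin_cf k.+2 (shift_digits n a) = ((shift_digits n a 0)%:R + v)^-1.
  by rewrite /v -sE.
have -> : fin_cf k.+1 (shift_digits n a) = ((shift_digits n a 0)%:R + u)^-1.
  by rewrite /u -sE.
set A := (shift_digits n a 0)%:R in an2 *.
have u2 : 2 <= A + u by lra.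
have v2 : 2 <= A + v by lra.
have -> : (A + v)^-1 - (A + u)^-1 = (A + v)^-1 * (A + u)^-1 * (u - v).
  by field; rewrite !gt_eqF//; lra.
rewrite normrM exprS distrC; apply: ler_pM => //.
rewrite ger0_norm; last by rewrite mulr_ge0// invr_ge0; lra.
rewrite -[leRHS]mulr1; apply: ler_pM; rewrite ?invr_ge0 ?lef_pV2 ?posrE//; try lra.
by rewrite invf_le1; lra.
Qed.

Lemma is_cvg_fin_cf n : cvgn (fin_cf ^~ (shift_digits n a)).
Proof.
have -> : fin_cf ^~ (shift_digits n a) =
    series (telescope (fin_cf ^~ (shift_digits n a))).
  by rewrite telescopeK; apply/funext => k /=; rewrite subr0.
apply: normed_cvg; apply: (@series_le_cvg _ _ (geometric 1 2^-1)) => [k|k|k|].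
- exact: normr_ge0.
- by rewrite /geometric/= mul1r exprn_ge0.
- by rewrite /geometric/= mul1r; exact: fin_cf_step.
- by apply: is_cvg_geometric_series; rewrite ger0_norm// invf_lt1// ltr1n.
Qed.

Lemma inf_cf_itv0 n : 0 <= inf_cf (shift_digits n a) <= 2^-1.
Proof.
apply/andP; split.
  apply: limr_ge; first exact: is_cvg_fin_cf.
  by apply: nearW => k; have /andP[] := fin_cf_itv k n.
apply: limr_le; first exact: is_cvg_fin_cf.
by apply: nearW => k; have /andP[] := fin_cf_itv k n.
Qed.

Lemma inf_cfE n :
  inf_cf (shift_digits n a) = ((a n)%:R + inf_cf (shift_digits n.+1 a))^-1.
Proof.
have an2 : 2 <= (a n)%:R :> R by rewrite ler_nat a_ge2.
have /andP[h0 _] := inf_cf_itv0 n.+1.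
apply: cvg_lim => //; rewrite -cvg_shiftS.
apply: cvgV; first by rewrite gt_eqF//; lra.
apply: cvgD.
  by rewrite /shift_digits addn0; apply: cvg_cst.
rewrite (_ : shift_digits 1 _ = shift_digits n.+1 a); first exact: is_cvg_fin_cf.
by apply/funext => i; rewrite /shift_digits add1n addSnnS.
Qed.

Lemma inf_cf_itv n : 0 < inf_cf (shift_digits n a) <= 2^-1.
Proof.
have /andP[_ ->] := inf_cf_itv0 n; rewrite andbT inf_cfE invr_gt0.
have /andP[h0 _] := inf_cf_itv0 n.+1.
by rewrite ltr_wpDr// ltr0n (leq_trans _ (a_ge2 n)).
Qed.

Lemma inf_cf_orbit :
  cf_orbit (fun n => inf_cf (shift_digits n a)) (fun j => a j.-1).
Proof.
move=> n; have /andP[x0 x1] := inf_cf_itv n; split; last by rewrite inf_cfE invrK.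
by rewrite x0 (le_lt_trans x1)// invf_lt1// ltr1n.
Qed.

End Digits.
End InfiniteFraction.

(** * The map [cantor_map] and the Hölder bound for its inverse *)

Section CantorMap.
Context {R : realType}.
Implicit Types (t u s : R).

Definition cube_gap n := (3 * n ^ 2 + 3 * n + 1)%N.

Lemma cube_succ n : (n.+1 ^ 3 = n ^ 3 + cube_gap n)%N.
Proof. by rewrite /cube_gap !expnS expn0; nia. Qed.

Definition dyadic_floor n t := Num.truncn (2 ^+ (n ^ 3) * t).

(* The bits of [t] in positions [n ^ 3, (n + 1) ^ 3), with a leading 1. *)
Definition block t n :=
  (2 ^ cube_gap n + (dyadic_floor n.+1 t - 2 ^ cube_gap n * dyadic_floor n t))%N.

Definition cantor_map t : R := inf_cf (block t).

Lemma dyadic_floor_bounds n t : 0 <= t ->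
  (2 ^ cube_gap n * dyadic_floor n t <= dyadic_floor n.+1 t
   < 2 ^ cube_gap n * (dyadic_floor n t).+1)%N.
Proof.
move=> t0; have p0 m : 0 < 2 ^+ m :> R by rewrite exprn_gt0.
have y0 m : 0 <= 2 ^+ m * t by rewrite mulr_ge0// ltW.
have /andP[h1 h2] := truncn_itv (y0 (n ^ 3)%N).
rewrite /dyadic_floor truncn_ge_nat// truncn_lt_nat//.
have -> : 2 ^+ (n.+1 ^ 3) * t = 2 ^+ cube_gap n * (2 ^+ (n ^ 3) * t).
  by rewrite cube_succ exprD; ring.
by rewrite !natrM !natrX ler_pM2l// ltr_pM2l// h1 h2.
Qed.

(** The leading 1 fixes the size of the digit up to a factor 2, whatever the bits of [t] are. *)
Lemma block_bounds t n : 0 <= t ->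
  (2 ^ cube_gap n <= block t n < 2 ^ (cube_gap n).+1)%N.
Proof.
move=> t0; have /andP[h1 h2] := dyadic_floor_bounds n t0.
rewrite leq_addr/= /block expnS mul2n -addnn ltn_add2l.
by rewrite ltn_subLR// -mulnSr.
Qed.

Lemma block_ge2 t n : 0 <= t -> (2 <= block t n)%N.
Proof.
move=> t0; have /andP[h _] := block_bounds n t0; apply: leq_trans h.
by rewrite -[leqLHS]expn1 leq_exp2l// /cube_gap addn1.
Qed.

Lemma dyadic_floor0 t : 0 <= t < 1 -> dyadic_floor 0 t = 0%N.
Proof.
by move=> t01; rewrite /dyadic_floor expr0 mul1r; apply: truncn_def.
Qed.

Lemma dyadic_floor_eq n t u : 0 <= t < 1 -> 0 <= u < 1 ->
  (forall i, (i < n)%N -> block t i = block u i) ->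
  dyadic_floor n t = dyadic_floor n u.
Proof.
move=> t01 u01; elim: n => [|n IH] tu; first by rewrite !dyadic_floor0.
have {}IH := IH (fun i ni => tu i (ltnW ni)).
have /andP[t0 _] := t01; have /andP[u0 _] := u01.
have /andP[ht _] := dyadic_floor_bounds n t0.
have /andP[hu _] := dyadic_floor_bounds n u0.
have /addnI := tu n (ltnSn n); rewrite IH in ht * => h.
by rewrite -(subnK ht) h subnK.
Qed.

Lemma dyadic_floor_dist n t u : 0 <= t -> 0 <= u ->
  dyadic_floor n t = dyadic_floor n u -> `|t - u| <= 2 ^- (n ^ 3).
Proof.
move=> t0 u0 tu; have p0 : 0 < 2 ^+ (n ^ 3) :> R by rewrite exprn_gt0.
have /andP[] := truncn_itv (mulr_ge0 (ltW p0) t0).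
have /andP[] := truncn_itv (mulr_ge0 (ltW p0) u0).
rewrite -/(dyadic_floor n t) -/(dyadic_floor n u) tu -natr1 => h1 h2 h3 h4.
rewrite -div1r ler_pdivlMr// mulrC -{1}(gtr0_norm p0) -normrM mulrBr.
by rewrite ler_norml; apply/andP; split; lra.
Qed.

(** Equal blocks below [n] give equal floors at level [n], hence distance at most [2 ^ -(n ^ 3)].
    Were all blocks equal, this would hold for every [n] and force [t = u]. *)
Lemma first_block_diff t u : 0 <= t < 1 -> 0 <= u < 1 -> t != u ->
  exists n, [/\ block t n != block u n,
    (forall i, (i < n)%N -> block t i = block u i) &
    `|t - u| <= 2 ^- (n ^ 3)].
Proof.
move=> t01 u01 tu; have /andP[t0 _] := t01; have /andP[u0 _] := u01.
have dist n : (forall i, (i < n)%N -> block t i = block u i) ->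
    `|t - u| <= 2 ^- (n ^ 3).
  by move=> h; apply: dyadic_floor_dist => //; exact: dyadic_floor_eq.
have ex : exists n, block t n != block u n.
  apply: contrapT => nex.
  have tu0 : 0 < `|t - u| by rewrite normr_gt0 subr_eq0.
  have tu2 : 0 < `|t - u| / 2 by rewrite divr_gt0.
  have [N hN] := half_expn_lt tu2.
  have h i : block t i = block u i.
    by apply/eqP; apply: contrapT => ne; apply: nex; exists i; apply/negP.
  have := dist N (fun i _ => h i).
  have : 2 ^- (N ^ 3) <= 2^-1 ^+ N :> R.
    rewrite exprVn lef_pV2 ?posrE ?exprn_gt0// ler_weXn2l ?ler1n//.
    by case: (N) => // k; rewrite -[leqLHS]expn1 leq_pexp2l.
  by lra.
have [n ne nmin] := ex_minnP ex; exists n; split => //; last apply: dist => i.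
  by move=> i ni; apply/eqP; apply: contraLR ni => /nmin; rewrite -leqNgt.
by move=> ni; apply/eqP; apply: contraLR ni => /nmin; rewrite -leqNgt.
Qed.

Lemma cantor_orbit t : 0 <= t ->
  cf_orbit (fun n => inf_cf (shift_digits n (block t)) : R)
    (fun j => block t j.-1).
Proof. by move=> t0; apply: inf_cf_orbit => i; exact: block_ge2. Qed.

Lemma cantor_orbit_ge t n : 0 <= t ->
  2 ^- (cube_gap n).+1 <= inf_cf (shift_digits n (block t)) :> R.
Proof.
move=> t0; have [/andP[x0 _] xE] := cantor_orbit t0 n.
have [/andP[y0 y1] _] := cantor_orbit t0 n.+1.
rewrite -[leRHS]invrK lef_pV2 ?posrE ?exprn_gt0 ?invr_gt0// xE.
have /andP[_ h] := block_bounds n t0.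
apply: (@le_trans _ _ (block t n).+1%:R); first by rewrite -natr1/= lerD2l ltW.
by rewrite -natrX ler_nat.
Qed.

(** The exponents [cube_gap i + 1] for [i < n] add up to [n ^ 3 + n]. *)
Lemma prod_cantor_orbit_ge t n : 0 <= t ->
  2 ^- (n ^ 3 + n) <= \prod_(i < n) inf_cf (shift_digits i (block t)) :> R.
Proof.
move=> t0; elim: n => [|n IH]; first by rewrite big_ord0 expr0 invr1.
have -> : (n.+1 ^ 3 + n.+1 = (n ^ 3 + n) + (cube_gap n).+1)%N.
  by rewrite cube_succ; lia.
rewrite big_ord_recr/= exprD invfM.
by apply: ler_pM; rewrite ?invr_ge0 ?exprn_ge0//; exact: cantor_orbit_ge.
Qed.

(** One more step of the expansion after the common prefix turns [x_n - y_n] into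
    [x_n y_n (1 / y_n - 1 / x_n)]. Each of the two products of [n + 1] orbit points costs
    [(n + 1) ^ 3 + (n + 1)] bits, and the last factor one bit. *)
Lemma cantor_map_dist_ge t u n : 0 <= t -> 0 <= u ->
  block t n != block u n -> (forall i, (i < n)%N -> block t i = block u i) ->
  2 ^- ((n.+1 ^ 3 + n.+1).*2.+1) <= `|cantor_map t - cantor_map u|.
Proof.
move=> t0 u0 ne tu; have xa := cantor_orbit t0; have yb := cantor_orbit u0.
have -> : cantor_map t - cantor_map u = inf_cf (shift_digits 0 (block t)) -
    inf_cf (shift_digits 0 (block u)) by [].
rewrite (cf_orbit_sub xa yb tu).
have [/andP[x0 x1] xE] := xa n; have [/andP[y0 y1] yE] := yb n.
have /andP[x0' x1'] := @inf_cf_itv R _ (fun i => block_ge2 i t0) n.+1.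
have /andP[y0' y1'] := @inf_cf_itv R _ (fun i => block_ge2 i u0) n.+1.
have Px := prod_cantor_orbit_ge n.+1 t0; have Py := prod_cantor_orbit_ge n.+1 u0.
rewrite !big_ord_recr/= in Px Py.
move: Px Py; set P := \prod_(i < n) _; set Q := \prod_(i < n) _ => Px Py.
cbn beta in *.
set x := inf_cf (shift_digits n (block t)) in x0 x1 xE Px *.
set y := inf_cf (shift_digits n (block u)) in y0 y1 yE Py *.
have -> : x - y = x * y * (y^-1 - x^-1) by field; rewrite !gt_eqF.
rewrite !normrM (gtr0_norm x0) (gtr0_norm y0).
(* Distinct digits differ by at least 1, while the tails lie in [(0, 1/2]] and so differ by at most
   1/2. *)
have half : 2^-1 <= `|y^-1 - x^-1|.
  rewrite xE yE /=.
  have : 1 <= `|(block u n)%:R - (block t n)%:R| :> R.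
    rewrite ler_normr; move: ne; rewrite neq_ltn -2!(ler_nat R) -!natr1.
    by move=> /orP[] h; apply/orP; [left|right]; lra.
  by rewrite !ler_normr => /orP[] h; apply/orP; [left|right]; lra.
have -> : P * Q * (x * y * `|y^-1 - x^-1|) = P * x * (Q * y) * `|y^-1 - x^-1|.
  by ring.
rewrite exprS -addnn exprD !invfM mulrC; apply: ler_pM => //.
by apply: ler_pM => //; rewrite invr_ge0 exprn_ge0.
Qed.

(* [s (2 (n + 1) ^ 3 + ...) - n ^ 3] is bounded above as soon as [2 s < 1]. *)
Lemma exponent_bound s : 0 <= s < 2^-1 -> exists k : R, forall n : nat,
  s * ((n.+1 ^ 3 + n.+1).*2.+1)%:R <= k + (n ^ 3)%:R.
Proof.
move=> /andP[s0 s1]; pose e := 1 - 2 * s; have e0 : 0 < e by rewrite /e; lra.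
(* With [x = n] and [x <= x ^ 2], the left side minus [n ^ 3] is at most [x ^ 2 (7 - e x) + 5 / 2],
   where [7 = 3 + 4]. The bracket is positive only for [x < 7 / e]. *)
exists (7 * (7 / e) ^+ 2 + 3) => n.
pose x : R := n%:R; have x0 : 0 <= x by rewrite ler0n.
have -> : ((n.+1 ^ 3 + n.+1).*2.+1)%:R = 2 * ((x + 1) ^+ 3 + (x + 1)) + 1.
  by rewrite -natr1 -muln2 natrM natrD natrX -[n.+1%:R]natr1 mulrC.
rewrite natrX -/x.
have xx : x <= x ^+ 2.
  by rewrite /x -natrX ler_nat; case: (n) => // m; rewrite -[leqLHS]expn1 leq_pexp2l.
have -> : s = (1 - e) / 2 by rewrite /e; field.
have e1 : e <= 1 by rewrite /e; lra.
have main : x ^+ 2 * (7 - e * x) <= 7 * (7 / e) ^+ 2.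
  have [h|h] := lerP (7 / e) x.
    apply: (@le_trans _ _ 0); last by rewrite mulr_ge0// exprn_ge0// divr_ge0// ltW.
    rewrite mulr_ge0_le0 ?exprn_ge0// subr_le0.
    by move: h; rewrite ler_pdivrMr// mulrC.
  rewrite mulrC; apply: ler_pM; rewrite ?exprn_ge0//; last first.
  - by rewrite lerXn2r ?nnegrE// ltW// (le_lt_trans x0).
  - by rewrite gerBl mulr_ge0// ltW.
  - by move: h; rewrite ltr_pdivlMr// subr_ge0 mulrC => /ltW.
have ex0 : 0 <= e * x by rewrite mulr_ge0// ltW.
have ex2 : 0 <= e * x ^+ 2 by rewrite mulr_ge0// ?exprn_ge0// ltW.
have -> : (1 - e) / 2 * (2 * ((x + 1) ^+ 3 + (x + 1)) + 1) =
  x ^+ 3 + 3 * x ^+ 2 + 4 * x + 5 / 2 - e * x ^+ 3 - 3 * (e * x ^+ 2)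
   - 4 * (e * x) - e * (5 / 2) by field.
move: main; rewrite mulrBr.
have -> : x ^+ 2 * (e * x) = e * x ^+ 3 by ring.
by lra.
Qed.

(** At the first differing block [n] the upper bound for [|t - u|] meets the lower bound for the
    images; [exponent_bound] makes the constant independent of [n]. *)
Lemma cantor_map_holder s : 0 <= s < 2^-1 -> exists2 K : R, 0 < K &
  forall t u, 0 <= t < 1 -> 0 <= u < 1 ->
  `|t - u| <= K * `|cantor_map t - cantor_map u| `^ s.
Proof.
move=> s01; have /andP[s0 _] := s01; have [k hk] := exponent_bound s01.
exists (2 `^ k) => [|t u t01 u01]; first by rewrite powR_gt0.
have [->|tu] := eqVneq t u; first by rewrite subrr normr0 mulr_ge0// powR_ge0.
have [n [ne lt_n dist]] := first_block_diff t01 u01 tu.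
have /andP[t0 _] := t01; have /andP[u0 _] := u01.
have gdist := cantor_map_dist_ge t0 u0 ne lt_n.
apply: le_trans dist _.
apply: (@le_trans _ _ (2 `^ k * (2 ^- ((n.+1 ^ 3 + n.+1).*2.+1)) `^ s)); last first.
  by rewrite ler_wpM2l ?powR_ge0// ge0_ler_powR// nnegrE invr_ge0 exprn_ge0.
rewrite -!powR_mulrn// -!powRN -powRrM -powRD; last by rewrite pnatr_eq0 implybT.
by apply: ler_powR; [rewrite ler1n|have := hk n; lra].
Qed.

End CantorMap.

(** * Denominators and terms of the series at [cantor_map t] *)

Lemma cube_gapE n : cube_gap n = (2 * n + (3 * n ^ 2 + n + 1))%N.
Proof. by rewrite /cube_gap; lia. Qed.

Lemma cube_add_le_mul n : (n ^ 3 + n <= n * (3 * n ^ 2 + n + 1))%N.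
Proof. by rewrite !expnS expn0; nia. Qed.

Section CantorTerms.
Context {R : realType}.
Variable t : R.
Hypothesis t01 : 0 <= t < 1.
Let t0 : 0 <= t. Proof. by case/andP: t01. Qed.
Let q n := cf_denom (cantor_map t) n.
Let orbit := cantor_orbit t0.

Lemma cantor_denomE n : q n = (cf_denom_pair (fun j => block t j.-1) n).2.
Proof.
rewrite /q /cf_denom (@eq_cf_denom_pair _ (fun j => block t j.-1))//.
by move=> [//|i] _; rewrite -(cf_orbit_digit orbit).
Qed.

Lemma cantor_denom_leS n : (2 ^ cube_gap n * q n <= q n.+1)%N.
Proof.
rewrite !cantor_denomE; apply: leq_trans (cf_denom_leS _ _).
by rewrite leq_mul2r; have /andP[-> _] := block_bounds n t0; rewrite orbT.
Qed.

Lemma cantor_denom_bounds n : (2 ^ (n ^ 3) <= q n <= 2 ^ (n ^ 3 + n))%N.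
Proof.
elim: n => [//|n /andP[IH1 IH2]]; apply/andP; split.
  apply: leq_trans (cantor_denom_leS n).
  by rewrite cube_succ expnD mulnC leq_mul2l IH1 orbT.
rewrite cantor_denomE (leq_trans (cf_denomS_le _ _))//.
  by move=> i; exact: cf_orbit_digit_gt0 orbit.
rewrite -cantor_denomE.
have -> : (n.+1 ^ 3 + n.+1 = (cube_gap n).+1 + (n ^ 3 + n))%N.
  by rewrite cube_succ; lia.
by rewrite expnD leq_mul//; have /andP[_] := block_bounds n t0.
Qed.

Lemma ln2_ge : 2^-1 <= ln 2 :> R.
Proof.
have : ln (2^-1) <= - 2^-1 :> R.
  have := @le_ln1Dx R (- 2^-1); rewrite (_ : 1 + - 2^-1 = 2^-1 :> R); last by field.
  by apply; lra.
by rewrite lnV ?posrE//; lra.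
Qed.

Lemma cube_add_le n : (n ^ 3 + n <= 2 ^ (2 * n))%N.
Proof.
have [n4|] := ltnP n 4; first by move: n n4; do 4 case => //.
elim: n => [//|n IH]; rewrite leq_eqVlt => /orP[/eqP <-//|n4].
have -> : (2 * n.+1 = 2 + 2 * n)%N by lia.
rewrite expnD; have {IH} := IH n4; move: (2 ^ (2 * n))%N => X.
by rewrite !expnS !expn0; nia.
Qed.

(* [q_(n+1) / (q_n log q_n) >= 2 ^ (3 n ^ 2 + n + 1)] while
   [log q_n <= (n ^ 3 + n) log 2], so the iterated logarithms differ by at most
   [log n]. *)
Lemma cantor_W_le n : (0 < n)%N -> W (cantor_map t) n <= 2 / n%:R ^+ 2.
Proof.
move=> n0; have nR : 1 <= n%:R :> R by rewrite ler1n.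
have l2 := ln2_ge; have l2' := @ln2_le1 R.
have /andP[qlo qhi] := cantor_denom_bounds n.
have qS := cantor_denom_leS n.
have q0 : (0 < q n)%N by rewrite (leq_trans _ qlo)// expn_gt0.
have q0R : 0 < (q n)%:R :> R by rewrite ltr0n.
have q1R : 0 < (q n.+1)%:R :> R.
  by rewrite ltr0n (leq_trans _ qS)// muln_gt0 expn_gt0.
have lnE k : ln (2 ^+ k) = k%:R * ln 2 :> R by rewrite lnXn// mulr_natl.
have lqlo : (n ^ 3)%:R * ln 2 <= ln (q n)%:R :> R.
  by rewrite -lnE ler_ln ?posrE ?exprn_gt0// -natrX ler_nat.
have lqhi : ln (q n)%:R <= (n ^ 3 + n)%:R * ln 2 :> R.
  by rewrite -lnE ler_ln ?posrE ?exprn_gt0// -natrX ler_nat.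
have n3 : 1 <= (n ^ 3)%:R :> R by rewrite ler1n expn_gt0 n0.
have lq0 : 0 < ln (q n)%:R :> R by apply: lt_le_trans lqlo; rewrite mulr_gt0; lra.
(* As [cube_gap n = 2 n + m], the factor [2 ^ (2 n)] absorbs [log q_n] and leaves [2 ^ m]. *)
pose m := (3 * n ^ 2 + n + 1)%N.
have ratio : 2 ^+ m <= (q n.+1)%:R / ((q n)%:R * ln (q n)%:R) :> R.
  rewrite ler_pdivlMr ?mulr_gt0//.
  apply: (@le_trans _ _ (2 ^ cube_gap n * q n)%:R); last by rewrite ler_nat.
  rewrite cube_gapE -/m natrM natrX exprD.
  have : ln (q n)%:R <= 2 ^+ (2 * n) :> R.
    apply: le_trans lqhi _; apply: (@le_trans _ _ (n ^ 3 + n)%:R).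
      by rewrite -[leRHS]mulr1 ler_wpM2l.
    by rewrite -natrX ler_nat cube_add_le.
  have : 0 < 2 ^+ m :> R by rewrite exprn_gt0.
  set A := 2 ^+ (2 * n); set B := 2 ^+ m => B0 lA.
  have -> : A * B * (q n)%:R = B * ((q n)%:R * A) by ring.
  by rewrite !ler_pM2l.
have m1 : 2 <= 2 ^+ m :> R.
  by rewrite -natrX ler_nat -[leqLHS]expn1 leq_exp2l// /m addn1.
rewrite /W -/(q n) -/(q n.+1) ifN; last first.
  rewrite -leNgt -mulrA -ler_pdivlMr ?mulr_gt0//.
  exact: le_trans ratio.
set Q := _ / _ in ratio *.
have Q0 : 0 < Q by apply: lt_le_trans ratio; rewrite exprn_gt0.
have lnQ : m%:R * ln 2 <= ln Q by rewrite -lnE ler_ln ?posrE ?exprn_gt0.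
have mR : 1 <= m%:R :> R by rewrite ler1n /m addn1.
have ml0 : 0 < m%:R * ln 2 :> R by rewrite mulr_gt0; lra.
have lnQ0 : 0 < ln Q by apply: lt_le_trans lnQ.
have lln : ln (ln (q n)%:R) <= ln n%:R + ln (ln Q).
  rewrite -lnM ?posrE//; last by lra.
  rewrite ler_ln ?posrE//; last by rewrite mulr_gt0//; lra.
  apply: le_trans lqhi _; apply: (@le_trans _ _ (n%:R * (m%:R * ln 2))).
    rewrite mulrA ler_wpM2r//; first by lra.
    by rewrite -natrM ler_nat cube_add_le_mul.
  by rewrite ler_wpM2l//; lra.
have lnn : ln n%:R <= n%:R :> R.
  have := @le_ln1Dx R (n%:R - 1); rewrite [1 + _]addrC subrK => h.
  by apply: le_trans (h _) _; lra.
(* Both 1 and [log n] are at most [n], and [log q_n >= n ^ 3 / 2] because [log 2 >= 1 / 2]. *)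
apply: (@le_trans _ _ (n%:R / ln (q n)%:R)).
  by rewrite ler_wpM2r ?invr_ge0 ?(ltW lq0)// ge_max nR/=; lra.
rewrite ler_pdivrMr// -ler_pdivrMl ?divr_gt0 ?exprn_gt0//; try lra.
apply: le_trans lqlo; rewrite natrX invf_div.
have -> : n%:R ^+ 2 / 2 * n%:R = n%:R ^+ 3 * 2^-1 :> R by ring.
by rewrite ler_wpM2l// exprn_ge0//; lra.
Qed.

Lemma cantor_map_calA : calA R (cantor_map t).
Proof.
split.
- by have [] := orbit 0%N.
- exact: (cf_orbit_irrational orbit).
have a01 : 0 < cantor_map t < 1 by have [] := orbit 0%N.
have ia := cf_orbit_irrational orbit.
apply: (@le_lt_trans _ _ 4%:E); last by rewrite ltry.
apply: lime_le.
  by apply: is_cvg_nneseries => n _ /(W_ge0 a01 ia); rewrite lee_fin.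
apply: nearW => k; rewrite big_mkcond/=.
(* The majorant telescopes: [2 / i ^ 2 <= 4 / i - 4 / (i + 1)], as [i + 1 <= 2 i]. *)
have key m : \sum_(1 <= i < m.+1) 2 / i%:R ^+ 2 <= 4 - 4 / m.+1%:R :> R.
  elim: m => [|m IH]; first by rewrite big_geq// divr1 subrr.
  rewrite big_nat_recr//=; set x : R := m.+1%:R in IH *.
  have x1 : 1 <= x by rewrite /x ler1n.
  have -> : m.+2%:R = x + 1 :> R by rewrite natr1.
  apply: le_trans (lerD IH (lexx _)) _; rewrite -subr_ge0.
  have -> : 4 - 4 / (x + 1) - (4 - 4 / x + 2 / x ^+ 2) =
      2 * (x - 1) / (x ^+ 2 * (x + 1)).
    by field; rewrite !gt_eqF//; lra.
  by rewrite divr_ge0 ?mulr_ge0 ?exprn_ge0//; lra.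
case: k => [|k]; first by rewrite big_geq// lee_fin.
apply: (@le_trans _ _ (\sum_(1 <= i < k.+1) 2 / i%:R ^+ 2 : R)%:E); last first.
  by rewrite lee_fin (le_trans (key k))// gerBl divr_ge0.
rewrite -sumEFin big_nat [leRHS]big_nat; apply: lee_sum => i /andP[i1 _].
case: ifP => _; first by rewrite lee_fin cantor_W_le.
by rewrite lee_fin divr_ge0// exprn_ge0.
Qed.

End CantorTerms.

(** * The lower bound and the conclusion *)

Lemma calA_hausdorff_measure_gt0 (R : realType) (s : R) : 0 <= s < 2^-1 ->
  hausdorff_measure s (calA R) != 0%E.
Proof.
move=> s01; have /andP[s0 _] := s01; have [K K0 gK] := cantor_map_holder s01.
apply/eqP => H0.
(* A vanishing Hausdorff measure makes the premeasure at [delta = 1] vanish, although [[0, 1)] has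
   measure 1. *)
have := @lebesgue_le_hausdorff R `[0, 1[%classic (calA R) cantor_map K s 1 s0 K0.
rewrite lebesgue_measure_itv/= lte_fin ltr01 oppr0 adde0 => /(_ _ _)/wrap[].
- by move=> t; rewrite /= in_itv/=; exact: cantor_map_calA.
- by move=> t u; rewrite /= !in_itv/=; exact: gK.
apply/negP; rewrite -ltNge; apply: (@le_lt_trans _ _ 0%E); last by rewrite lte_fin.
rewrite -(mule0 (2 * K)%:E) lee_pmul2l//; last by rewrite lte_fin mulr_gt0.
rewrite -H0; apply: ereal_sup_ubound; exists 1 => //=.
Qed.

Theorem theorem1p3 (R : realType) :
  lebesgue_measure (calA R) = 0%E /\
  hausdorff_dim (calA R) = (2^-1)%:E.
Proof.
split.
  apply: hausdorff_measure1_null.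
  have -> : 1 = 2^-1 + 2^-1 :> R by field.
  exact: calA_hausdorff_measure0.
apply/eqP; rewrite eq_le; apply/andP; split.
  apply/lee_addgt0Pr => e e0; apply: ge_ereal_inf; exists (2^-1 + e)%:E => //.
  exists (2^-1 + e) => //; split; last exact: calA_hausdorff_measure0.
  by rewrite addr_ge0// ltW.
apply/ereal_infP => _ [s [s0 /eqP Hs] <-]; rewrite lee_fin leNgt.
by apply: contraL Hs => s1; apply: calA_hausdorff_measure_gt0; rewrite s0.
Qed.
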